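(* Let $\mathcal C$ be a class of Baire spaces such that every open subspace of a space in $\mathcal C$ belongs to $\mathcal C$. A topological space $X$ is $\mathcal C$-Piotrowski if one of the following conditions is satisfied: (1) $X$ is a subspace of a $\mathcal C$-Piotrowski space; (2) $X$ is a countable union of closed subspaces of $X$ which are $\mathcal C$-Piotrowski; (3) each non-empty subspace $Y\subset X$ contains a non-empty relatively open subspace $Z\subset Y$ which is $\mathcal C$-Piotrowski. The same holds with ''$\mathcal C$-Piotrowski'' replaced everywhere (in the hypotheses and in the conclusion) by ''strong $\mathcal C$-Piotrowski''.
   Context: A topological space is Baire if the intersection of any sequence of its open dense subsets is dense. A function $f:Z\to X$ between topological spaces is quasicontinuous if for every $z\in Z$, every neighborhood $O_z$ of $z$ in $Z$ and every neighborhood $O_{f(z)}$ of $f(z)$ in $X$ there is a non-empty open set $U\subset O_z$ with $f(U)\subset O_{f(z)}$. A subset of a space is meager if it is a countable union of nowhere dense sets, and comeager if its complement is meager. For a class $\mathcal C$ of Baire spaces, a topological space $X$ is $\mathcal C$-Piotrowski if every quasicontinuous map $f:C\to X$ defined on a non-empty space $C\in\mathcal C$ has a continuity point; $X$ is strong $\mathcal C$-Piotrowski if for every quasicontinuous map $f:C\to X$ defined on a space $C\in\mathcal C$ the set $C(f)$ of continuity points of $f$ is comeager in $C$. *)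

(* Defs.v *)
From HB Require Import structures.
From mathcomp Require Import all_boot all_order all_algebra.
From mathcomp Require Import all_classical topology.

Set Implicit Arguments.
Unset Strict Implicit.
Unset Printing Implicit Defensive.

Local Open Scope classical_set_scope.

(* A subspace is always the type [set_type A] with the topology induced by the
   inclusion into the ambient space, not the library's [subspace A], which lives
   on the whole ambient type and makes every point outside A isolated. *)

Definition baire_space (T : topologicalType) : Prop :=
  forall F : nat -> set T,
    (forall n, open (F n) /\ dense (F n)) -> dense (\bigcap_n F n).

Definition nowhere_dense (T : topologicalType) (A : set T) : Prop :=
  interior (closure A) = set0.

Definition meager (T : topologicalType) (A : set T) : Prop :=
  exists F : nat -> set T,
    (forall n, nowhere_dense (F n)) /\ A = \bigcup_n F n.

Definition comeager (T : topologicalType) (A : set T) : Prop := meager (~` A).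

Definition quasicontinuous (Z X : topologicalType) (f : Z -> X) : Prop :=
  forall (z : Z) (Oz : set Z) (Ofz : set X),
    nbhs z Oz -> nbhs (f z) Ofz ->
    exists U : set Z, [/\ open U, U !=set0, U `<=` Oz & f @` U `<=` Ofz].

Definition continuity_points (Z X : topologicalType) (f : Z -> X) : set Z :=
  [set z | {for z, continuous f}].

Definition piotrowski (C : topologicalType -> Prop) (X : topologicalType) :
    Prop :=
  forall Z : topologicalType, C Z -> [set: Z] !=set0 ->
  forall f : Z -> X, quasicontinuous f -> continuity_points f !=set0.

Definition strong_piotrowski (C : topologicalType -> Prop)
    (X : topologicalType) : Prop :=
  forall Z : topologicalType, C Z ->
  forall f : Z -> X, quasicontinuous f -> comeager (continuity_points f).

Definition embedding (X Y : topologicalType) (e : X -> Y) : Prop :=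
  injective e /\
  forall A : set X, open A <-> exists2 B : set Y, open B & A = e @^-1` B.

(* Being a subspace is read up to homeomorphism; for A : set Y, the inclusion
   of [set_type A] into Y is an embedding. *)
Definition subspace_of_space_with (P : topologicalType -> Prop)
    (X : topologicalType) : Prop :=
  exists Y : topologicalType, P Y /\ exists e : X -> Y, embedding e.

Definition countable_closed_union_with (P : topologicalType -> Prop)
    (X : topologicalType) : Prop :=
  exists G : set (set X),
    [/\ countable G,
        forall F : set X, G F -> closed F /\ P (set_type F)
      & \bigcup_(F in G) F = [set: X]].

(* Z = U `&` Y with U open in X is a relatively open subset of Y; its topology
   as a subspace of Y is the one it inherits from X. *)
Definition hereditarily_locally_with (P : topologicalType -> Prop)
    (X : topologicalType) : Prop :=
  forall Y : set X, Y !=set0 ->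
    exists Z : set X,
      [/\ Z !=set0,
          exists2 U : set X, open U & Z = U `&` Y
        & P (set_type Z)].

(* Main.v *)
Require Import Defs.
From HB Require Import structures.
From mathcomp Require Import all_boot all_order all_algebra.
From mathcomp Require Import all_classical topology.

Local Open Scope classical_set_scope.

(** The last two sufficient conditions, the countable closed union and the
    hereditary one, reduce to one local situation. Let [f : Z -> X] be
    quasicontinuous with [Z] in the class. Under either condition, every
    non-empty open subset of [Z] contains a non-empty open [W] that [f] sends
    into some subset [A] of [X] which is a (strong) Piotrowski space
    ([locally_factors]). As [W] is open, the corestriction [W -> A] of [f] is
    again quasicontinuous, its domain is again in the class, and [f] is
    continuous wherever the corestriction is ([open_corestriction]). Hence [f]
    has a continuity point in [W], respectively is continuous at all points of
    [W] outside a meager set. In the first case nothing more is needed. In the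
    second one the Banach category theorem ([meager_local]) glues the local
    pieces: a set whose trace on some non-empty open subset of each non-empty
    open set is meager is itself meager.

    For a countable union of closed pieces, the local situation comes from
    Baire category: the preimages of the pieces cover the Baire space [Z], so
    the interiors of their closures have a dense union ([baire_cover_dense]),
    and quasicontinuity turns density into inclusion: on the interior of the
    closure of the preimage of a closed set [F], all values of [f] are in [F]
    ([quasicontinuous_interior_closure]).
    Under the hereditary condition it comes from the image of an open set [V]:
    some open [U] meets [f @` V] in a Piotrowski space, and quasicontinuity
    provides a non-empty open [W] inside [V] with [f @` W] inside [U].

    A subspace of a Piotrowski space needs no localization: composing with an
    embedding changes neither quasicontinuity nor the continuity points. *)

(** * Nowhere dense and meager sets *)

Lemma nowhere_denseP {T : topologicalType} (A : set T) :
  nowhere_dense A <->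
  forall O, open O -> O !=set0 ->
    exists V, [/\ open V, V !=set0, V `<=` O & V `&` A = set0].
Proof.
split=> [A0 O Oo O0|nA].
  exists (O `\` closure A); split.
  - by apply: openI => //; apply: closed_openC; exact: closed_closure.
  - have [//|/set0P/negP/negPn/eqP OA] := pselect (O `\` closure A !=set0).
    have [x Ox] := O0; suff : set0 x by [].
    by move: OA; rewrite setD_eq0 (open_subsetE _ Oo) -A0; exact.
  - by move=> x [].
  - by rewrite -subset0 => x [[_ Ax]] /subset_closure.
apply/eqP; apply/negPn/negP => /set0P A0.
have [V [Vo [v Vv] VA V0]] := nA _ (open_interior _) A0.
have [y [Ay Vy]] : A `&` V !=set0.
  by apply: (interior_subset (VA _ Vv)); exact: open_nbhs_nbhs.
by have : set0 y by rewrite -V0.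
Qed.

Lemma nowhere_dense_subset {T : topologicalType} (A B : set T) :
  A `<=` B -> nowhere_dense B -> nowhere_dense A.
Proof.
move=> AB /nowhere_denseP nB; apply/nowhere_denseP => O Oo O0.
have [V [Vo V0 VO VB]] := nB O Oo O0; exists V; split => //.
by rewrite -subset0 -VB; exact: setIS.
Qed.

Lemma meagerP {T : topologicalType} (A : set T) :
  meager A <-> exists F : nat -> set T,
    (forall n, nowhere_dense (F n)) /\ A `<=` \bigcup_n F n.
Proof.
split=> [[F [nF ->]]|[F [nF AF]]]; first by exists F; split.
exists (fun n => A `&` F n); split.
  by move=> n; apply: nowhere_dense_subset (nF n) => x [].
by rewrite -setI_bigcupr; apply/esym/setIidl.
Qed.

(** The Banach category theorem. A maximal disjoint family [M] of open sets [W]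
    with [W `&` A] meager has a dense union; and because [M] is disjoint, the
    [n]-th nowhere dense pieces of the sets [W `&` A], one for each [W] in [M],
    have a nowhere dense union however large [M] is. *)
Lemma meager_local {T : topologicalType} (A : set T) :
  (forall V, open V -> V !=set0 ->
    exists W, [/\ open W, W !=set0, W `<=` V & meager (W `&` A)]) ->
  meager A.
Proof.
move=> locA.
pose D : set (set T) := [set W | [/\ open W, W !=set0 & meager (W `&` A)]].
have [M [MD tM maxM]] := ex_maximal_disjoint_subcollection id D.
have meetM O : open O -> O !=set0 ->
    exists W V, [/\ M W, open V, V !=set0, V `<=` O & V `<=` W].
  move=> Oo O0; have [W [Wo W0 WO mW]] := locA O Oo O0.
  have [[W' [MW' WW']]|nW] := pselect (exists W', M W' /\ W `&` W' !=set0).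
    exists W', (W `&` W'); split => //.
    - by have [? _ _] := MD _ MW'; exact: openI.
    - by move=> x [/WO].
  (* Otherwise [W] could be added to [M]. *)
  have MW : ~ M W by move=> MW; apply: nW; exists W; rewrite setIid.
  exfalso; apply: (maxM (M `|` [set W])).
  - split; first by move=> x; left.
    by move=> sub; apply: MW; apply: sub; right.
  - by move=> _ [/MD //|->].
  - move=> X Y [MX|->] [MY|->] //= XY; first exact: tM.
      by exfalso; apply: nW; exists X; rewrite setIC.
    by exfalso; apply: nW; exists Y.
have /choice[N NP] : forall W, exists F : nat -> set T, M W ->
    (forall n, nowhere_dense (F n)) /\ W `&` A `<=` \bigcup_n F n.
  move=> W; have [MW|nMW] := pselect (M W); last by exists (fun=> set0).
  by have [_ _ /meagerP[F FP]] := MD _ MW; exists F.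
(* Points of [A] outside the union of [M] are caught at index [0]: that union
   is open and dense, so its complement is nowhere dense. *)
pose F n := if n is n'.+1 then \bigcup_(W in M) (W `&` N W n')
            else ~` \bigcup_(W in M) W.
apply/meagerP; exists F; split.
  move=> n; apply/nowhere_denseP => O Oo O0.
  have [W [V [MW Vo V0 VO VW]]] := meetM O Oo O0.
  case: n => [|n] /=.
    exists V; split => //; rewrite -subset0 => x [Vx]; apply.
    by exists W => //; exact: VW.
  have /nowhere_denseP/(_ V Vo V0)[V' [V'o V'0 V'V V'N]] := (NP W MW).1 n.
  (* [V'] lies in [W], so by disjointness it meets the piece of [W] only. *)
  exists V'; split => //; first exact: subset_trans VO.
  rewrite -subset0 => x [V'x [W' MW' [W'x Nx]]]; rewrite -V'N; split => //.
  suff -> : W = W' by [].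
  by apply: tM => //; exists x; split => //; exact/VW/V'V.
move=> x Ax; have [[W MW Wx]|nM] := pselect ((\bigcup_(W in M) W) x).
  by have [n _ Nx] := (NP W MW).2 x (conj Wx Ax); exists n.+1 => //; exists W.
by exists 0.
Qed.

(** The sets [interior (closure (A n)) `|` ~` closure (A n)] are open and dense,
    and a point of [A n] in such a set is in [interior (closure (A n))]. *)
Lemma baire_cover_dense {Z : topologicalType} (A : nat -> set Z) :
  baire_space Z -> \bigcup_n A n = setT ->
  dense (\bigcup_n interior (closure (A n))).
Proof.
move=> bZ covA O O0 Oo.
have [n|z [Oz capz]] :=
    bZ (fun n => interior (closure (A n)) `|` ~` closure (A n)) _ O O0 Oo.
  split.
    apply: openU; first exact: open_interior.
    by apply: closed_openC; exact: closed_closure.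
  move=> U [u Uu] Uo; have [|] := pselect (U `<=` closure (A n)).
    rewrite (open_subsetE _ Uo) => UA.
    by exists u; split => //; left; exact: UA.
  by move=> /existsNP[x /not_implyP[Ux nAx]]; exists x; split => //; right.
have [n _ Anz] : (\bigcup_n A n) z by rewrite covA.
exists z; split => //; exists n => //.
by case: (capz n I) => // /(_ (subset_closure Anz)).
Qed.

(** * Embeddings and open subspaces *)

Lemma set_val_embedding {X : topologicalType} (A : set X) :
  embedding (set_val : set_type A -> X).
Proof.
split; first exact: val_inj.
by move=> B; split=> [[U Uo <-]|[U Uo ->]]; exists U.
Qed.

(** Both quasicontinuity and continuity at a point see the codomain only through
    its neighborhoods, so this lemma is all that is used of an embedding. *)
Lemma embedding_nbhsP {X Y : topologicalType} {e : X -> Y} :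
  embedding e -> forall x (O : set X),
  nbhs x O <-> exists2 B, nbhs (e x) B & e @^-1` B `<=` O.
Proof.
move=> [_ eo] x O; split.
  rewrite nbhsE => -[U [/eo[B Bo ->] Bx] BO].
  by exists B => //; exact: open_nbhs_nbhs.
move=> [B]; rewrite !nbhsE => -[U [Uo Ux] UB] BO.
exists (e @^-1` U); last by move=> y /UB/BO.
by split => //; apply/eo; exists U.
Qed.

Lemma embedding_quasicontinuous {Z X Y : topologicalType} {e : X -> Y}
    {f : Z -> X} :
  embedding e -> quasicontinuous (e \o f) <-> quasicontinuous f.
Proof.
move=> ee; split=> qf z O Q zO fQ.
  have [B Bz BQ] := (embedding_nbhsP ee _ _).1 fQ.
  have [U [Uo U0 UO UB]] := qf z O B zO Bz.
  exists U; split => // _ [u Uu <-].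
  by apply: BQ; apply: UB; exists u.
have [|U [Uo U0 UO UQ]] := qf z O (e @^-1` Q) zO.
  by apply/(embedding_nbhsP ee); exists Q.
exists U; split => // _ [u Uu <-].
by apply: (UQ (f u)); exists u.
Qed.

Lemma embedding_continuous_at {Z X Y : topologicalType} {e : X -> Y}
    {f : Z -> X} (z : Z) :
  embedding e -> {for z, continuous (e \o f)} <-> {for z, continuous f}.
Proof.
move=> ee; split=> cf B.
  move=> /(embedding_nbhsP ee)[Q /cf fQ QB].
  suff : nbhs z (f @^-1` B) by [].
  have {}fQ : nbhs z ((e \o f) @^-1` Q) by exact: fQ.
  by apply: filterS fQ => y; exact: QB.
move=> eB; apply: (cf (e @^-1` B)).
by apply/(embedding_nbhsP ee); exists B.
Qed.

Lemma set_val_open {Z : topologicalType} (W : set Z) : open W ->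
  forall U : set (set_type W), open U -> open (set_val @` U).
Proof.
move=> Wo _ [B Bo <-].
suff -> : set_val @` (set_val @^-1` B : set (set_type W)) = B `&` W.
  exact: openI.
apply/seteqP; split=> [_ [w Bw <-]|x [Bx Wx]].
  by split => //; exact: set_valP.
by exists (SigSub (mem_set Wx)).
Qed.

(** A nowhere dense subset of an open subspace stays nowhere dense in the whole
    space: an open set that meets [W] can be shrunk inside [W], and one that
    does not avoids the set anyway. *)
Lemma set_val_meager {Z : topologicalType} (W : set Z) (N : set (set_type W)) :
  open W -> meager N -> meager (set_val @` N).
Proof.
move=> Wo /meagerP[F [nF NF]]; apply/meagerP.
exists (fun n => set_val @` F n); split; last first.
  by move=> _ [w /NF[n _ Fw] <-]; exists n => //; exists w.
move=> n; apply/nowhere_denseP => O Oo O0.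
have [[x [Ox Wx]]|OW] := pselect (O `&` W !=set0); last first.
  exists O; split => //; rewrite -subset0 => x [Ox [w _ wx]].
  by apply: OW; exists x; split => //; rewrite -wx; exact: set_valP.
have /nowhere_denseP/(_ (set_val @^-1` O))[||V [Vo [v Vv] VO VF]] := nF n.
- by exists O.
- by exists (SigSub (mem_set Wx)).
exists (set_val @` V); split.
- exact: set_val_open.
- by exists (set_val v); exists v.
- by move=> _ [w /VO ? <-].
- rewrite -subset0 => _ [[w Vw <-] [w' Fw' /val_inj ww']].
  by suff : set0 w by []; rewrite -VF; split => //; rewrite -ww'.
Qed.

(** * Quasicontinuous maps with values locally in good subspaces *)

(** As [W] is open, a neighborhood in [W] is also one in [Z]; so the open set
    that quasicontinuity of [f] provides can be required to lie inside it, and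
    its trace on [W] is then non-empty. *)
Lemma open_restriction_quasicontinuous {Z X : topologicalType} (f : Z -> X)
    (W : set Z) :
  open W -> quasicontinuous f ->
  quasicontinuous (f \o (set_val : set_type W -> Z)).
Proof.
move=> Wo qf w O Q; rewrite nbhsE => -[O' [O'o O'w] O'O] fQ.
have [|U [Uo [u Uu] UO UQ]] := qf (set_val w) (set_val @` O') Q _ fQ.
  by apply: open_nbhs_nbhs; split; [exact: set_val_open|exists w].
exists (set_val @^-1` U); split.
- by exists U.
- by have [w' _ w'u] := UO _ Uu; exists w'; rewrite /preimage/= w'u.
- by move=> w' /UO[w'' O'w'' /val_inj <-]; exact: O'O.
- by move=> _ [w' Uw' <-]; apply: UQ; exists (set_val w').
Qed.

Lemma open_restriction_continuous_at {Z X : topologicalType} (f : Z -> X)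
    (W : set Z) (w : set_type W) :
  open W -> {for w, continuous (f \o (set_val : set_type W -> Z))} ->
  {for set_val w, continuous f}.
Proof.
move=> Wo cf B /cf; rewrite /= nbhs_filterE nbhsE => -[U [Uo Uw] UB].
suff : nbhs (set_val w) (set_val @` U).
  by apply: filterS => _ [w' /UB ? <-].
by apply: open_nbhs_nbhs; split; [exact: set_val_open|exists w].
Qed.

Lemma open_corestriction {Z X : topologicalType} {f : Z -> X} {W : set Z}
    {A : set X} :
  quasicontinuous f -> open W -> f @` W `<=` A ->
  exists2 g : set_type W -> set_type A, quasicontinuous g &
    forall w, {for w, continuous g} -> {for set_val w, continuous f}.
Proof.
move=> qf Wo WA.
have fA (w : set_type W) : A (f (set_val w)).
  by apply: WA; exists (set_val w) => //; exact: set_valP.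
have ee := set_val_embedding A.
exists (fun w => SigSub (mem_set (fA w))).
  apply/(embedding_quasicontinuous ee).
  exact: open_restriction_quasicontinuous.
move=> w /(embedding_continuous_at _ ee).
exact: open_restriction_continuous_at.
Qed.

Definition locally_factors (P : topologicalType -> Prop)
    {Z X : topologicalType} (f : Z -> X) :=
  forall V : set Z, open V -> V !=set0 ->
    exists W : set Z, [/\ open W, W !=set0, W `<=` V &
      exists2 A : set X, P (set_type A) & f @` W `<=` A].

(** A value outside [F] would, by quasicontinuity, produce a non-empty open
    subset of the interior of the closure of [f @^-1` F] that misses
    [f @^-1` F]. *)
Lemma quasicontinuous_interior_closure {Z X : topologicalType} {f : Z -> X}
    {F : set X} :
  quasicontinuous f -> closed F ->
  f @` interior (closure (f @^-1` F)) `<=` F.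
Proof.
move=> qf Fc _ [z Wz <-]; apply: contrapT => nFz.
have [||U [Uo [u Uu] UW UF]] :=
    qf z (interior (closure (f @^-1` F))) (~` F).
- by apply: open_nbhs_nbhs; split => //; exact: open_interior.
- by apply: open_nbhs_nbhs; split => //; exact: closed_openC.
have [y [Fy Uy]] : f @^-1` F `&` U !=set0.
  by apply: (interior_subset (UW _ Uu)); exact: open_nbhs_nbhs.
by apply: (UF (f y)) => //; exists y.
Qed.

Lemma countable_closed_union_locally_factors {P : topologicalType -> Prop}
    {Z X : topologicalType} (f : Z -> X) :
  baire_space Z -> quasicontinuous f -> countable_closed_union_with P X ->
  locally_factors P f.
Proof.
move=> bZ qf [G [cG GP GX]] V Vo V0.
have [G0|[F]] := pfcard_geP cG.
  have [v _] := V0; suff : [set: X] (f v) by rewrite -GX G0 bigcup_set0.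
  by [].
have GF n : G (F n) by exact: funS.
have covF : \bigcup_n f @^-1` F n = [set: Z].
  rewrite -subTset => z _.
  have [B GB Bz] : (\bigcup_(B in G) B) (f z) by rewrite GX.
  have [n _ nB] := @surj _ _ _ _ F B GB.
  by exists n => //=; rewrite nB.
have [z [Vz [n _ Wz]]] := baire_cover_dense _ bZ covF V V0 Vo.
exists (V `&` interior (closure (f @^-1` F n))); split.
- by apply: openI => //; exact: open_interior.
- by exists z.
- by move=> x [].
- have [Fc PF] := GP _ (GF n); exists (F n) => //.
  move=> _ [x [_ Wx] <-].
  by apply: (quasicontinuous_interior_closure qf Fc); exists x.
Qed.

Lemma hereditarily_locally_locally_factors {P : topologicalType -> Prop}
    {Z X : topologicalType} (f : Z -> X) :
  quasicontinuous f -> hereditarily_locally_with P X -> locally_factors P f.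
Proof.
move=> qf hX V Vo [v Vv].
have [|A [[y Ay] [U Uo AE] PA]] := hX (f @` V); first by exists (f v), v.
move: Ay; rewrite AE => -[Uy [z Vz zy]].
have [||W [Wo W0 WV WU]] := qf z V U.
- exact: open_nbhs_nbhs.
- by apply: open_nbhs_nbhs; rewrite zy.
exists W; split => //; exists A => //.
rewrite AE => x fx; split; first exact: WU.
by case: fx => w /WV Vw <-; exists w.
Qed.

Section local_to_global.
Context {C : topologicalType -> Prop}.
Hypothesis C_open : forall (Z : topologicalType) (U : set Z),
  C Z -> open U -> C (set_type U).
Context {Z X : topologicalType} {f : Z -> X}.
Hypotheses (CZ : C Z) (qf : quasicontinuous f).

Lemma locally_factors_continuity_points :
  [set: Z] !=set0 -> locally_factors (piotrowski C) f ->
  continuity_points f !=set0.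
Proof.
move=> Z0 /(_ _ openT Z0)[W [Wo [w Ww] _ [A PA WA]]].
have [g qg cg] := open_corestriction qf Wo WA.
have [||w' cw'] := PA (set_type W) _ _ g qg.
- exact: C_open.
- by exists (SigSub (mem_set Ww)).
- by exists (set_val w'); exact: cg.
Qed.

Lemma locally_factors_comeager_continuity_points :
  locally_factors (strong_piotrowski C) f -> comeager (continuity_points f).
Proof.
move=> lf; apply: meager_local => V Vo V0.
have [W [Wo W0 WV [A PA WA]]] := lf V Vo V0.
exists W; split => //.
have [g qg cg] := open_corestriction qf Wo WA.
have /(set_val_meager _ _ Wo)/meagerP[F [nF gF]] :=
  PA (set_type W) (C_open _ _ CZ Wo) g qg.
apply/meagerP; exists F; split => // x [Wx nfx].
apply: gF; exists (SigSub (mem_set Wx)) => // cgx.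
exact: nfx (cg _ cgx).
Qed.

End local_to_global.

Lemma subspace_piotrowski (C : topologicalType -> Prop) (X : topologicalType) :
  subspace_of_space_with (piotrowski C) X -> piotrowski C X.
Proof.
move=> [Y [PY [e ee]]] Z CZ Z0 f /(embedding_quasicontinuous ee) qf.
have [z cz] := PY Z CZ Z0 _ qf.
by exists z; apply/(embedding_continuous_at z ee).
Qed.

Lemma subspace_strong_piotrowski (C : topologicalType -> Prop)
    (X : topologicalType) :
  subspace_of_space_with (strong_piotrowski C) X -> strong_piotrowski C X.
Proof.
move=> [Y [PY [e ee]]] Z CZ f /(embedding_quasicontinuous ee) qf.
suff -> : continuity_points f = continuity_points (e \o f) by exact: PY.
by apply/seteqP; split=> z /(embedding_continuous_at z ee).
Qed.

Theorem theorem9p1 (C : topologicalType -> Prop)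
  (C_baire : forall Z : topologicalType, C Z -> baire_space Z)
  (C_open : forall (Z : topologicalType) (U : set Z),
     C Z -> open U -> C (set_type U)) :
  (forall X : topologicalType,
     [\/ subspace_of_space_with (piotrowski C) X,
         countable_closed_union_with (piotrowski C) X
       | hereditarily_locally_with (piotrowski C) X] ->
     piotrowski C X)
  /\
  (forall X : topologicalType,
     [\/ subspace_of_space_with (strong_piotrowski C) X,
         countable_closed_union_with (strong_piotrowski C) X
       | hereditarily_locally_with (strong_piotrowski C) X] ->
     strong_piotrowski C X).
Proof.
split=> X [sX|uX|hX].
- exact: subspace_piotrowski.
- move=> Z CZ Z0 f qf.
  apply: (locally_factors_continuity_points C_open CZ qf Z0).
  exact: countable_closed_union_locally_factors (C_baire _ CZ) qf uX.
- move=> Z CZ Z0 f qf.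
  apply: (locally_factors_continuity_points C_open CZ qf Z0).
  exact: hereditarily_locally_locally_factors qf hX.
- exact: subspace_strong_piotrowski.
- move=> Z CZ f qf.
  apply: (locally_factors_comeager_continuity_points C_open CZ qf).
  exact: countable_closed_union_locally_factors (C_baire _ CZ) qf uX.
- move=> Z CZ f qf.
  apply: (locally_factors_comeager_continuity_points C_open CZ qf).
  exact: hereditarily_locally_locally_factors qf hX.
Qed.
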